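(* Let $X$ be a Polish space without isolated points and let $f\colon X\to\mathbb{R}$. Then: (a) if $f$ has the HSOP with respect to $\mathrm{Perf}$, then $f$ is Marczewski measurable; (b) given a finite nonatomic Borel measure $\mu$ on $X$, if $f$ has the HSOP with respect to $\mathrm{Perf}^+$, then $f$ is measurable with respect to the completion $\overline{\mu}$ of $\mu$; (c) if $f$ has the HSOP with respect to $\mathrm{G_{Res}}$, then $f$ is Baire measurable. Consequently, for each $\Sigma\in\{\mathrm{Perf},\mathrm{Perf}^+,\mathrm{G_{Res}}\}$, $f$ has the HSOP with respect to $\Sigma$ if and only if $f$ has the HCRP with respect to $\Sigma$.
   Context: $\mathrm{Perf}$ is the family of all non-empty perfect (closed without isolated points) subsets of $X$. $\mathrm{Perf}^+$ is the family of all perfect subsets of $X$ of positive $\mu$-measure. $\mathrm{G_{Res}}$ is the family of all $G_\delta$ sets $G\subseteq X$ for which there is a non-empty open set $U$ such that $G$ is residual in $U$ (i.e. $G\subseteq U$ and $U\setminus G$ is meager). A set $E\subseteq X$ is an $(s)$-set if for each $P\in\mathrm{Perf}$ there is $Q\in\mathrm{Perf}$ such that either $Q\subseteq P\cap E$ or $Q\subseteq P\setminus E$; the $(s)$-sets form a $\sigma$-algebra. A function $f\colon X\to\mathbb{R}$ is Marczewski measurable if it is measurable with respect to the $\sigma$-algebra of $(s)$-sets. It is Baire measurable if it is measurable with respect to the $\sigma$-algebra of sets with the Baire property. For $g\colon A\to\mathbb{R}$ with $A\subseteq X$ and $x\in A$, $\operatorname{osc}(g,x):=\lim_{\varepsilon\to0^+}\operatorname{diam}(g(A\cap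 B(x,\varepsilon)))$, where $B(x,\varepsilon)$ is the open ball in $X$ (for a compatible metric). Given a family $\Sigma$ of non-empty subsets of $X$, $f$ has the hereditary continuous restriction property (HCRP) with respect to $\Sigma$ if for each $P\in\Sigma$ there is $Q\in\Sigma$, $Q\subseteq P$, such that $f\restriction Q$ is continuous; $f$ has the hereditary small oscillation property (HSOP) with respect to $\Sigma$ if for every $\alpha>0$ and each $P\in\Sigma$ there is $Q\in\Sigma$, $Q\subseteq P$, such that $\operatorname{osc}(f\restriction Q,x)<\alpha$ for all $x\in Q$. *)

(* Defs.v *)
From HB Require Import structures.
From mathcomp Require Import all_boot all_order all_algebra.
From mathcomp Require Import all_classical all_reals all_analysis borel_hierarchy.
From mathcomp Require Import measurable_realfun.

Set Implicit Arguments.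
Unset Strict Implicit.
Unset Printing Implicit Defensive.

Import Order.TTheory GRing.Theory Num.Theory.
Import numFieldNormedType.Exports.

Local Open Scope classical_set_scope.
Local Open Scope ring_scope.

Definition separable (X : topologicalType) :=
  exists2 D : set X, countable D & dense D.

Definition complete_metric (R : realType) (Y : metricType R) :=
  forall F : set_system Y, ProperFilter F -> cauchy F -> exists y : Y, F --> y.

Definition homeomorphic (X Y : topologicalType) :=
  exists (h : X -> Y) (g : Y -> X),
    [/\ cancel h g, cancel g h, continuous h & continuous g].

Definition completely_metrizable (R : realType) (X : topologicalType) :=
  exists2 Y : metricType R, complete_metric Y & homeomorphic X Y.

Definition polish (R : realType) (X : topologicalType) :=
  separable X /\ completely_metrizable R X.

Section category.
Context {X : topologicalType}.
Implicit Types A E G U : set X.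

Definition nowhere_dense A := interior (closure A) = set0.

Definition meager A :=
  exists2 F : (set X)^nat, (forall n, nowhere_dense (F n)) &
    A `<=` \bigcup_n F n.

Definition residual_in G U := G `<=` U /\ meager (U `\` G).

Definition baire_property E := exists2 U, open U & meager (E `+` U).

End category.

Section families.
Context {X : topologicalType}.

Definition Perf : set (set X) := [set P | perfect_set P /\ P !=set0].

Definition Perf_pos (R : realType) (mu : set X -> \bar R) : set (set X) :=
  [set P | perfect_set P /\ (0 < mu P)%E].

Definition G_Res : set (set X) :=
  [set G | Gdelta G /\
    exists U : set X, [/\ open U, U !=set0 & residual_in G U]].

Definition s_set (E : set X) :=
  forall P, Perf P ->
    exists2 Q, Perf Q & (Q `<=` P `&` E \/ Q `<=` P `\` E).

End families.

(* Measurability with respect to a family S of sets, without an ambient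
   measurableType; S is meant to be a sigma-algebra. *)
Definition measurable_for (X : Type) (R : realType) (S : set (set X))
    (f : X -> R) :=
  forall B : set R, measurable B -> S (f @^-1` B).

Definition marczewski_measurable (R : realType) (X : topologicalType)
    (f : X -> R) := measurable_for s_set f.

Definition baire_measurable (R : realType) (X : topologicalType)
    (f : X -> R) := measurable_for baire_property f.

(* measurableType's are pointed, so the Borel space of X is built from an
   arbitrary base point x0, which plays no other role. *)
Definition pointed_at (X : topologicalType) (x0 : X) : Type := X.

HB.instance Definition _ (X : topologicalType) (x0 : X) :=
  Choice.copy (pointed_at x0) X.
HB.instance Definition _ (X : topologicalType) (x0 : X) :=
  isPointed.Build (pointed_at x0) x0.

Notation borelType x0 := (@g_sigma_algebraType (pointed_at x0) open).

Definition nonatomic d (T : measurableType d) (R : realType)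
    (mu : set T -> \bar R) :=
  forall A, measurable A -> (0 < mu A)%E ->
    exists B, [/\ measurable B, B `<=` A, (0 < mu B)%E & (mu B < mu A)%E].

Section oscillation.
Context {R : realType}.

Definition diam (A : set R) : \bar R :=
  ereal_sup [set `|p.1 - p.2|%:E | p in A `*` A].

(* osc A f x is the oscillation at x of the restriction of f to A. *)
Definition osc (X : metricType R) (A : set X) (f : X -> R) (x : X) : \bar R :=
  lim (diam (f @` (A `&` ball x e)) @[e --> (0 : R)^'+]).

Definition HCRP (X : topologicalType) (Sigma : set (set X)) (f : X -> R) :=
  forall P, Sigma P ->
    exists Q, [/\ Sigma Q, Q `<=` P & {within Q, continuous f}].

Definition HSOP (X : metricType R) (Sigma : set (set X)) (f : X -> R) :=
  forall (alpha : R) P, 0 < alpha -> Sigma P ->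
    exists Q, [/\ Sigma Q, Q `<=` P &
      forall x, Q x -> (osc Q f x < alpha%:E)%E].

End oscillation.

(* Main.v *)
Require Import Defs.
From mathcomp Require Import all_boot all_order all_algebra.
From mathcomp Require Import all_classical all_reals all_analysis.
From mathcomp Require Import measurable_realfun borel_hierarchy lra.

(** The three families are treated alike, through two properties of a family
    [Sigma] of sets.  It is locally rich when every member contains a member
    whose non-empty relatively open parts again contain members.  It has fusion
    when, given countably many subfamilies [D_ n], each dense in [Sigma] for
    inclusion, every member of [Sigma] contains a member [Q] which, for all [n]
    at once, is covered by relatively open parts each lying inside an element
    of [D_ n].

    Both implications follow from this formally.  If [f] has the small
    oscillation property, local richness makes the sets with [f]-image of
    diameter less than [1/(n+1)] dense, and the [Q] given by fusion carries a
    continuous restriction of [f] ([HSOP_HCRP]).  Call [E] decided by [Sigma]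
    when every member contains a member inside [E] or inside its complement
    (for perfect sets these are the (s)-sets).  If countably many sets are
    decided, fusion applied to the members that decide them yields a [Q] in
    which all of them are relatively open; so is their union, and local
    richness decides it.  Thus the decided sets form a sigma-algebra, and
    preimages of intervals are decided by the same argument applied to a
    continuous restriction ([HCRP_decided]).

    Fusion holds for a different reason in each case.  For perfect sets it is a
    Cantor scheme ([Perf_has_fusion]).  For perfect sets of positive measure
    and for residual G-delta sets it is an exhaustion: a dense [D] contains
    countably many elements that fill the space up to a null
    ([Perf_pos_exhaustion]) or meager ([G_Res_exhaustion]) set, and each of
    these becomes relatively open once a set of small measure, respectively a
    meager set, is thrown away.  The same exhaustions show that decided sets
    are measurable for the completion, respectively have the Baire property. *)

Set Implicit Arguments.
Unset Strict Implicit.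
Unset Printing Implicit Defensive.

Import Order.TTheory GRing.Theory Num.Theory.
Import numFieldNormedType.Exports.

Local Open Scope classical_set_scope.
Local Open Scope ring_scope.

(** * Families with fusion and the sets they decide *)

Section bases.
Context {X : topologicalType}.
Implicit Types (Sigma D : set (set X)) (P Q W E : set X).

(** For a family [Sigma], the Marczewski-Burstin algebra that it generates. *)
Definition decided Sigma E := forall P, Sigma P ->
  exists2 Q, Sigma Q & (Q `<=` P `&` E \/ Q `<=` P `\` E).

Definition dense_in Sigma D := forall P, Sigma P ->
  exists Q, [/\ Sigma Q, D Q & Q `<=` P].

(** The open set may depend on the point and the pieces may overlap: this is
    all that continuity and relative openness, being local, require. *)
Definition locally_in D Q := forall x, Q x ->
  exists W C, [/\ open W, W x, D C & W `&` Q `<=` C].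

(** The passage to a smaller [Q] is there for the positive measure case: an
    open set can meet a set of positive measure in a null set, but not if that
    set is the support of the restricted measure. *)
Definition locally_rich Sigma := forall P, Sigma P ->
  exists Q, [/\ Sigma Q, Q `<=` P & forall W, open W -> W `&` Q !=set0 ->
    exists2 Q', Sigma Q' & Q' `<=` W `&` Q].

Definition has_fusion Sigma := forall D_ : nat -> set (set X),
  (forall n, dense_in Sigma (D_ n)) -> forall P, Sigma P ->
  exists Q, [/\ Sigma Q, Q `<=` P & forall n, locally_in (D_ n) Q].

Lemma locally_inS D Q Q' : Q' `<=` Q -> locally_in D Q -> locally_in D Q'.
Proof.
move=> QQ' DQ x /QQ' /DQ[W [C [oW Wx DC WQC]]]; exists W, C; split => // y [Wy].
by move=> /QQ' Qy; exact: WQC.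
Qed.

Lemma decided_dense Sigma E : decided Sigma E ->
  dense_in Sigma [set Q | Q `<=` E \/ Q `<=` ~` E].
Proof.
move=> dE P /dE[Q SQ QPE]; exists Q; split => //.
- by case: QPE => QPE; [left|right] => x /QPE[].
- by case: QPE => QPE x /QPE[].
Qed.

Lemma decidedC Sigma E : decided Sigma E -> decided Sigma (~` E).
Proof.
move=> dE P /dE[Q SQ QPE]; exists Q => //.
by rewrite setDE setCK; case: QPE; [right|left].
Qed.

(** If [E] misses the rich set [Q], then [Q] lies in its complement; otherwise
    [E] contains a non-empty relatively open part of [Q], hence a member. *)
Lemma decided_relatively_open Sigma E : locally_rich Sigma ->
  (forall P, Sigma P -> exists Q, [/\ Sigma Q, Q `<=` P &
     forall x, Q x -> E x -> exists W, [/\ open W, W x & W `&` Q `<=` E]]) ->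
  decided Sigma E.
Proof.
move=> rich locE P /locE[Q1 [/rich[Q [SQ QQ1 richQ]] Q1P oE]].
have [QE|/set0P QE] := eqVneq (Q `&` E) set0.
  exists Q => //; right => x Qx; split; first exact/Q1P/QQ1.
  by move=> Ex; have : (Q `&` E) x by []; rewrite QE.
have [x [Qx Ex]] := QE; have [W [oW Wx WE]] := oE x (QQ1 _ Qx) Ex.
have [|Q' SQ' Q'WQ] := richQ W oW; first by exists x.
exists Q' => //; left => y /Q'WQ[Wy Qy]; split; first exact/Q1P/QQ1.
by apply: WE; split => //; exact: QQ1.
Qed.

(** Fusion over the members that decide each [E_ n] gives a [Q] in which every
    [E_ n] is relatively open, a property that passes to the union. *)
Lemma decided_bigcup Sigma (E_ : nat -> set X) :
  locally_rich Sigma -> has_fusion Sigma ->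
  (forall n, decided Sigma (E_ n)) -> decided Sigma (\bigcup_n E_ n).
Proof.
move=> rich fus dE; apply: decided_relatively_open => // P SP.
have [Q [SQ QP locQ]] := fus _ (fun n => decided_dense (dE n)) P SP.
exists Q; split => // x Qx [n _ Enx].
have [W [C [oW Wx DC WQC]]] := locQ n x Qx.
exists W; split => // y /WQC Cy; exists n => //.
by case: DC => CE; [exact: CE|have /CE := WQC x (conj Wx Qx)].
Qed.

End bases.

(** * Oscillation and continuous restrictions *)

Section restriction_properties.
Context {R : realType} {X : metricType R}.
Implicit Types (Sigma : set (set X)) (f : X -> R) (Q : set X).

Lemma within_continuous_locP Q f : {within Q, continuous f} <->
  forall x, Q x -> forall e, 0 < e ->
  exists W, [/\ open W, W x & forall y, W y -> Q y -> `|f x - f y| < e].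
Proof.
rewrite subspace_continuousP; split => cf x Qx.
- move=> e e0; have /cvgrPdist_lt /(_ e e0) := cf x Qx.
  rewrite /within /= nbhsE => -[W [oW Wx] WQ].
  by exists W; split => // y Wy Qy; exact: WQ.
- apply/cvgrPdist_lt => e e0; have [W [oW Wx WQ]] := cf x Qx e e0.
  rewrite /within /= nbhsE; exists W; first by split.
  by move=> y Wy Qy; exact: WQ.
Qed.

(** The diameter decreases with the radius, so the limit is an infimum. *)
Lemma oscE Q f x : osc Q f x =
  ereal_inf [set diam (f @` (Q `&` ball x e)) | e in [set e | 0 < e]].
Proof.
rewrite /osc; apply: cvg_lim => //.
have -> : [set e : R | 0 < e] = [set` Interval (BRight 0) +oo%O].
  by apply/seteqP; split => e /=; rewrite in_itv /= andbT.
apply: nondecreasing_at_right_cvge => // a b _ _ ab; apply: ereal_sup_le.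
apply: image_subset => -[_ _] [/= [y [Qy xy] <-] [z [Qz xz] <-]].
by split; [exists y|exists z] => //; split => //;
  [exact: le_ball xy|exact: le_ball xz].
Qed.

Lemma osc_lt Q f x (a : R) : (osc Q f x < a%:E)%E ->
  exists2 e, 0 < e & forall y z, Q y -> Q z -> ball x e y -> ball x e z ->
    `|f y - f z| < a.
Proof.
rewrite oscE => /ereal_inf_lt[_ [e /= e0 <-] da]; exists e => // y z Qy Qz xy xz.
rewrite -lte_fin; apply: le_lt_trans da; apply: ereal_sup_ubound.
by exists (f y, f z) => //; split; [exists y|exists z].
Qed.

Lemma osc_le Q f x (a e : R) : 0 < e ->
  (forall y z, Q y -> Q z -> ball x e y -> ball x e z -> `|f y - f z| <= a) ->
  (osc Q f x <= a%:E)%E.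
Proof.
move=> e0 fa; rewrite oscE; apply: ge_ereal_inf; exists (diam (f @` (Q `&` ball x e))).
  by exists e.
apply: ge_ereal_sup => _ [[_ _] [/= [y [Qy xy] <-] [z [Qz xz] <-]] <-].
by rewrite lee_fin fa.
Qed.

Lemma HCRP_HSOP Sigma f : HCRP Sigma f -> HSOP Sigma f.
Proof.
move=> fc a P a0 /fc[Q [SQ QP /within_continuous_locP cf]].
exists Q; split => // x Qx.
have [W [oW Wx Wf]] := cf x Qx (a / 4) (divr_gt0 a0 (ltr0n _ 4)).
have /nbhs_ballP[e /= e0 eW] : nbhs x W by exact: open_nbhs_nbhs.
apply: (@le_lt_trans _ _ (a / 2)%:E); last by rewrite lte_fin gtr_pMr ?invf_lt1 ?ltr1n.
apply: (osc_le e0) => y z Qy Qz /eW Wy /eW Wz.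
have := Wf y Wy Qy; have := Wf z Wz Qz.
rewrite !ltr_norml ler_norml => /andP[? ?] /andP[? ?].
by apply/andP; split; lra.
Qed.

Definition small_image f n : set (set X) :=
  [set Q | forall x y, Q x -> Q y -> `|f x - f y| < n.+1%:R^-1].

(** Small oscillation at one point of a locally rich subset bounds the diameter
    of the image of a whole relatively open part, which contains a member. *)
Lemma HSOP_dense_small_image Sigma f n : locally_rich Sigma ->
  HSOP Sigma f -> dense_in Sigma (small_image f n).
Proof.
move=> rich oscf P SP.
have [|Q1 [SQ1 Q1P Q1f]] := oscf n.+1%:R^-1 P _ SP; first by rewrite invr_gt0 ltr0n.
have [Q [SQ QQ1 richQ]] := rich Q1 SQ1.
have [Q0|/set0P [x Qx]] := eqVneq Q set0.
  exists Q; split => //; last exact: subset_trans Q1P.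
  by move=> y z; rewrite Q0.
have [e e0 fe] := osc_lt (Q1f x (QQ1 _ Qx)).
have [||Q' SQ' Q'Q] := richQ (ball x e)^°.
- exact: open_interior.
- by exists x; split => //; apply: nbhsx_ballx.
exists Q'; split => //.
- move=> y z /Q'Q[/interior_subset xy /QQ1 Qy] /Q'Q[/interior_subset xz /QQ1 Qz].
  exact: fe.
- by move=> y /Q'Q[_ /QQ1 /Q1P].
Qed.

Lemma locally_small_image_continuous Q f :
  (forall n, locally_in (small_image f n) Q) -> {within Q, continuous f}.
Proof.
move=> locQ; apply/within_continuous_locP => x Qx e e0.
have [n ne] : exists n : nat, n.+1%:R^-1 < e.
  have /= [n _ ne] := near_infty_natSinv_lt (PosNum e0).
  by exists n; apply: ne => /=.
have [W [C [oW Wx Cf WC]]] := locQ n x Qx; exists W; split => // y Wy Qy.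
by apply: lt_trans ne; apply: Cf; apply: WC.
Qed.

Lemma HSOP_HCRP Sigma f : locally_rich Sigma -> has_fusion Sigma ->
  HSOP Sigma f -> HCRP Sigma f.
Proof.
move=> rich fus oscf P SP.
have [Q [SQ QP locQ]] := fus _ (fun n => HSOP_dense_small_image n rich oscf) P SP.
by exists Q; split => //; exact: locally_small_image_continuous.
Qed.

Lemma HCRP_decided Sigma f : locally_rich Sigma -> has_fusion Sigma ->
  HCRP Sigma f -> measurable_for (decided Sigma) f.
Proof.
move=> rich fus cf B mB.
have {mB} : (@ocitv R).-sigma.-measurable B by exact: mB.
rewrite RGenOpens.measurableE => mB.
apply: (@smallest_sub _ _ _ [set A | decided Sigma (f @^-1` A)] _ _ _ mB).
- split => /=.
  + move=> P SP; exists P => //; right; rewrite preimage_set0 setD0 //.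
  + by move=> A dA; rewrite setTD preimage_setC; exact: decidedC.
  + by move=> F dF; rewrite preimage_bigcup; exact: decided_bigcup.
- move=> _ [a [b ->]] /=; apply: decided_relatively_open => // P SP.
  have [Q [SQ QP /within_continuous_locP cQ]] := cf P SP.
  exists Q; split => // x Qx; rewrite /= in_itv /= => /andP[ax xb].
  have [|W [oW Wx Wf]] := cQ x Qx (Num.min (f x - a) (b - f x)).
    by rewrite lt_min !subr_gt0 ax.
  exists W; split => // y [Wy Qy]; rewrite /= in_itv /=.
  have := Wf y Wy Qy; rewrite lt_min !ltr_norml => /andP[/andP[? ?] /andP[? ?]].
  by apply/andP; split; lra.
Qed.

Lemma HSOP_decided Sigma f : locally_rich Sigma -> has_fusion Sigma ->
  HSOP Sigma f -> measurable_for (decided Sigma) f.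
Proof. by move=> rich fus /(HSOP_HCRP rich fus); exact: HCRP_decided. Qed.

End restriction_properties.

(** * Complete metrizability as a notion of smallness *)

Section gauge.
Context {X : topologicalType}.

(** The trace of a complete metric in terms of sets alone: [small n A] stands
    for a bound [1/(n+1)] on the diameter of [A].  It lets nested constructions
    be carried out inside [X] although the complete metric lives on a
    homeomorphic copy of it. *)
Record gauge (small : nat -> set (set X)) : Prop := Gauge {
  gaugeS : forall m n A B, (m <= n)%N -> A `<=` B -> small n B -> small m A;
  gauge_nbhs : forall n (x : X), exists2 V, nbhs x V & small n V;
  gauge_base : forall (x : X) W, nbhs x W ->
    exists n, forall A, small n A -> A x -> A `<=` W;
  gauge_complete : forall A : nat -> set X,
    (forall n, closed (A n)) -> (forall n, A n !=set0) ->
    (forall n, A n.+1 `<=` A n) -> (forall n, small n (A n)) ->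
    \bigcap_n A n !=set0 }.

Lemma gauge_completely_metrizable (R : realType) :
  completely_metrizable R X -> exists small, gauge small.
Proof.
move=> [Y cY [h [g [hK gK ch cg]]]].
exists (fun n A => forall y z, A y -> A z -> ball (h y) n.+1%:R^-1 (h z)).
split.
- move=> m n A B mn AB sB y z /AB By /AB Bz; apply: le_ball (sB y z By Bz).
  by rewrite lef_pV2 ?posrE ?ltr0n// ler_nat ltnS.
- move=> n x; exists (h @^-1` ball (h x) (n.+1%:R^-1 / 2)).
    by apply: ch; apply: nbhsx_ballx; rewrite divr_gt0 ?invr_gt0 ?ltr0n.
  by move=> y z /= /ball_sym xy xz; have := ball_triangle xy xz; rewrite -splitr.
- move=> x W xW.
  have /nbhs_ballP[e /= e0 eW] : nbhs (h x) (g @^-1` W).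
    by apply: cg; rewrite hK.
  have /= [n _ ne] := near_infty_natSinv_lt (PosNum e0).
  exists n => A sA Ax y Ay; rewrite -(hK y); apply: eW.
  by apply: le_ball (sA x y Ax Ay); exact/ltW/ne/leqnn.
- move=> A cA A0 AS sA.
  have AD m n : (m <= n)%N -> A n `<=` A m.
    move=> /subnK <-; elim: (n - m)%N => // k IH; rewrite addSn.
    exact: subset_trans (AS _) IH.
  have [u uA] := choice A0.
  have [|y uy] := cY ((h \o u) @ \oo) _.
    apply/cauchy_ballP => e e0.
    have /= [n _ ne] := near_infty_natSinv_lt (PosNum e0).
    rewrite near_map2; near=> i j.
    apply: le_ball (sA n (u i) (u j) _ _); first exact/ltW/ne/leqnn.
      by apply: (AD n i) => //; near: i; exact: nbhs_infty_ge.
    by apply: (AD n j) => //; near: j; exact: nbhs_infty_ge.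
  exists (g y) => n _; apply: (cA n).
  have gu : g \o (h \o u) @ \oo --> g y by apply: cvg_comp uy _; exact: cg.
  move=> V /gu /= [m _ mV]; exists (u (maxn m n)); split.
    by apply: (AD n (maxn m n)); rewrite ?leq_maxr.
  by have := mV (maxn m n) (leq_maxl _ _); rewrite /= hK.
Unshelve. all: by end_near. Qed.

End gauge.

(** * Perfect sets *)

Section perfect.
Context {R : realType} {X : metricType R}.
Implicit Types (P Q W : set X).

(** A relatively open part of a perfect set is dense in itself, and the closure
    of a set dense in itself is perfect. *)
Lemma perfect_closure P W : perfect_set P -> open W ->
  perfect_set (closure (W `&` P)).
Proof.
move=> [cP lP] oW; have cWP := @closed_closure _ (W `&` P).
split => //; apply/seteqP; split => x.
  by move=> /subset_limit_point; rewrite -(closure_id _).1.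
move=> xWP N xN; have [y [[Wy Py] Ny]] := xWP _ (nbhs_interior xN).
have : limit_point P y by rewrite lP.
have oWN : open (W `&` N^°) by apply: openI => //; exact: open_interior.
move=> /(_ _ (open_nbhs_nbhs (conj oWN (conj Wy Ny)))) [z [zy Pz [Wz Nz]]].
have [xy|xy] := eqVneq y x.
  exists z; split; [by rewrite -xy|exact: subset_closure|exact: interior_subset].
exists y; split; [exact: xy|exact: subset_closure|exact: interior_subset].
Qed.

(** The open set [V] is returned along with the perfect set because the measure
    of [V `&` P] bounds that of its closure from below. *)
Lemma perfect_piece P W x : perfect_set P -> open W -> W x -> P x ->
  exists V, [/\ open V, V x, Perf (closure (V `&` P)) &
    closure (V `&` P) `<=` W `&` P].
Proof.
move=> pP oW Wx Px; have [N xN NW] := uniform_regular (open_nbhs_nbhs (conj oW Wx)).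
have oN := @open_interior _ N.
exists N^°; split => //.
  split; first exact: perfect_closure.
  by exists x; apply: subset_closure; split.
move=> y /closureI[Ny Py]; split; last by rewrite (closure_id P).1 //; case: pP.
exact/NW/(closure_subset (@interior_subset _ N)).
Qed.

Lemma Perf_locally_rich : locally_rich (@Perf X).
Proof.
move=> P PP; exists P; split => // W oW [x [Wx Px]].
have [V [_ _ PV VW]] := perfect_piece PP.1 oW Wx Px.
by exists (closure (V `&` P)).
Qed.

Context (small : nat -> set (set X)) (small_gauge : gauge small).

Lemma Perf_split D n P : dense_in Perf D -> Perf P ->
  exists A : bool -> set X, [/\
    forall b, [/\ Perf (A b), A b `<=` P, D (A b) & small n (A b)] &
    A true `&` A false = set0].
Proof.
move=> dD PP.
have shrink x N : nbhs x N -> P x ->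
    exists Q, [/\ Perf Q, Q `<=` N `&` P, D Q & small n Q].
  move=> xN Px; have [V xV sV] := gauge_nbhs small_gauge n x.
  have oNV := @open_interior _ (N `&` V).
  have NVx : (N `&` V)^° x by apply: filterI.
  have [U [_ _ PU UNV]] := perfect_piece PP.1 oNV NVx Px.
  have [Q [PQ DQ QU]] := dD _ PU; exists Q; split => //.
    by move=> y /QU /UNV[/interior_subset[]].
  apply: (gaugeS small_gauge (leqnn n) _ sV).
  by move=> y /QU /UNV[/interior_subset[]].
have [x Px] := PP.2.
have : limit_point P x by rewrite PP.1.2.
move=> /(_ _ filterT)[y [yx Py _]].
have := @metric_hausdorff _ X; rewrite open_hausdorff => /(_ x y).
rewrite eq_sym => /(_ yx)[[N M]] /= [/set_mem Nx /set_mem My] [oN oM /eqP NM].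
have [Q [PQ QN DQ sQ]] := shrink x N (open_nbhs_nbhs (conj oN Nx)) Px.
have [Q' [PQ' QM DQ' sQ']] := shrink y M (open_nbhs_nbhs (conj oM My)) Py.
exists (fun b => if b then Q else Q'); split.
  by case; split => //; [move=> z /QN[]|move=> z /QM[]].
apply/seteqP; split => // z [/QN[Nz _] /QM[Mz _]].
by have : (N `&` M) z by []; rewrite NM.
Qed.

Lemma finite_bitseqs n : finite_set [set s : seq bool | size s = n].
Proof.
apply: (@sub_finite_set _ _ (range (@tval n bool))).
  by move=> s /= /eqP sn; exists (Tuple sn).
exact/finite_image/finite_finset.
Qed.

(** A Cantor scheme: a node [s] of the binary tree carries a perfect set [T s],
    the two children of a node are disjoint, small, and in [D_ (size s)], and
    [Q] is the set of points that lie on every level.  Completeness puts a point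
    of [Q] in every node, so that [Q] has no isolated point; and [Q] splits at
    each level into finitely many disjoint closed parts, which are therefore
    relatively open. *)
Lemma Perf_has_fusion : has_fusion (@Perf X).
Proof.
move=> D_ dD P PP.
have [A AP] : {A : nat * set X -> bool -> set X & forall nQ, Perf nQ.2 ->
    [/\ forall b, [/\ Perf (A nQ b), A nQ b `<=` nQ.2, D_ nQ.1 (A nQ b) &
       small nQ.1 (A nQ b)] & A nQ true `&` A nQ false = set0]}.
  apply: (@choice _ _ (fun nQ A => Perf nQ.2 ->
    [/\ forall b, [/\ Perf (A b), A b `<=` nQ.2, D_ nQ.1 (A b) &
       small nQ.1 (A b)] & A true `&` A false = set0])) => -[n Q].
  have [PQ|nPQ] := pselect (Perf Q).
    by have [A AP] := Perf_split n (dD n) PQ; exists A.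
  by exists (fun=> set0) => /nPQ.
(* A node is written with its most recent bit first. *)
pose T := fix T s := if s is b :: s' then A (size s', T s') b else P.
have TP s : Perf (T s).
  by elim: s => //= b s /(AP (size s, T s))[/(_ b)[]].
have TS b s : T (b :: s) `<=` T s.
  by have [/(_ b)[]] := AP (size s, T s) (TP s).
have TD b s : D_ (size s) (T (b :: s)).
  by have [/(_ b)[]] := AP (size s, T s) (TP s).
have Tsmall b s : small (size s) (T (b :: s)).
  by have [/(_ b)[]] := AP (size s, T s) (TP s).
have Tinj s t x : size s = size t -> T s x -> T t x -> s = t.
  elim: s t => [[]//|b s IH [//|c t]] [st] Tsx Ttx.
  have {}IH := IH t st (TS _ _ _ Tsx) (TS _ _ _ Ttx); rewrite -{}IH in Ttx *.
  have [_ AI] := AP (size s, T s) (TP s).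
  have nboth : A (size s, T s) true x -> ~ A (size s, T s) false x.
    by move=> At Af; rewrite -[False]/(set0 x) -AI.
  by congr (_ :: _); move: Tsx Ttx => /=; case: b c => -[] // /[swap] /nboth.
have Ttrunc n s x : (n <= size s)%N -> T s x -> exists2 t, size t = n & T t x.
  elim: s => [|b s IH]; first by rewrite leqn0 => /eqP -> ?; exists [::].
  rewrite leq_eqVlt => /predU1P[-> ?|]; first by exists (b :: s).
  by rewrite ltnS => ns /TS; exact: IH.
pose Q := \bigcap_n \bigcup_(s in [set s | size s = n]) T s.
have QT s : (T s `&` Q) !=set0.
  (* Any branch through [s] would do; the one that always turns to [false]
     shrinks to a point of [Q]. *)
  pose B n := T (nseq n false ++ s).
  have cB n : closed (B n) by case: (TP (nseq n false ++ s)) => -[].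
  have B0 n : B n !=set0 by case: (TP (nseq n false ++ s)).
  have BS n : B n.+1 `<=` B n by exact: TS.
  have Bsmall n : small n (B n.+1).
    (* The node [B n.+1] has [n + size s + 1] bits, so it is small to the
       order [n + size s]. *)
    apply: (gaugeS small_gauge _ _ (Tsmall false (nseq n false ++ s))) => //.
    by rewrite size_cat size_nseq leq_addr.
  have [x Bx] := gauge_complete small_gauge (fun n => cB n.+1)
    (fun n => B0 n.+1) (fun n => BS n.+1) Bsmall.
  exists x; split; first exact/(BS 0%N)/Bx.
  move=> n _; have [|t tn Ttx] := Ttrunc n _ _ _ (BS _ _ (Bx n I)).
    by rewrite size_cat size_nseq leq_addr.
  by exists t.
have cQ : closed Q.
  apply: closed_bigI => n _; apply: closed_bigcup; first exact: finite_bitseqs.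
  by move=> s _; case: (TP s) => -[].
exists Q; split.
- split; last by have [x [_ Qx]] := QT [::]; exists x.
  split => //; apply/seteqP; split => x.
    by move=> /subset_limit_point; rewrite -(closure_id _).1.
  move=> Qx N /(gauge_base small_gauge)[n nN].
  have [[//|b s] /= [sn] Tx] := Qx n.+1 I.
  have TN : T (b :: s) `<=` N by apply: nN => //; rewrite -sn.
  (* The two children of the node around [x] hold distinct points of [Q]; one
     of them is not [x]. *)
  have [y [Ty Qy]] := QT (true :: b :: s).
  have [z [Tz Qz]] := QT (false :: b :: s).
  have [yx|yx] := eqVneq y x; last first.
    by exists y; split => //; apply: TN; exact: TS Ty.
  exists z; split => //; last by apply: TN; exact: TS Tz.
  apply/eqP => zx; rewrite zx -yx in Tz.
  by have := Tinj _ _ _ _ Ty Tz => /(_ erefl).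
- by move=> x /(_ 0%N I)[[|//] _].
- move=> n x Qx; have [[//|b s] /= [sn] Tx] := Qx n.+1 I.
  exists (~` \bigcup_(t in [set t | size t = n.+1] `\ (b :: s)) T t), (T (b :: s)).
  split => //.
  + apply/closed_openC/closed_bigcup; last by move=> t _; case: (TP t) => -[].
    by apply: finite_setD; exact: finite_bitseqs.
  + by move=> [t [/= tn tbs] Ttx]; apply: tbs; apply: (Tinj _ _ x) => //; rewrite tn /= sn.
  + by rewrite -sn; exact: TD.
  + move=> y [nTy /(_ n.+1 I)[t /= tn Tty]].
    have [tbs|tbs] := pselect (t = b :: s); first by rewrite tbs in Tty.
    by case: nTy; exists t.
Qed.

End perfect.

(** * Countable bases and meager sets *)

Section sequences_of_sets.
Context {T : Type}.

Lemma bigcup_double_seq (C : nat -> nat -> set T) : exists C' : nat -> set T,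
  (forall i, C' i = set0 \/ exists n k, C' i = C n k) /\
  \bigcup_i C' i = \bigcup_n \bigcup_k C n k.
Proof.
exists (fun i => if unpickle i is Some p then C p.1 p.2 else set0); split.
  by move=> i; case: unpickle => [[n k]|]; [right; exists n, k|left].
apply/seteqP; split => x.
  by move=> [i _]; case: unpickle => // -[n k] Cx; exists n => //; exists k.
by move=> [n _ [k _ Cx]]; exists (pickle (n, k)) => //; rewrite pickleK.
Qed.

End sequences_of_sets.

Section countable_base.
Context {X : topologicalType}.

Definition countable_base (B : nat -> set X) :=
  (forall n, open (B n)) /\
  forall x W, open W -> W x -> exists n, B n x /\ B n `<=` W.

End countable_base.

(** Balls centred at a dense countable set; [e] numbers the centres, so that
    [C i m] is the interior of the ball of radius [1/(m+1)] around the centre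
    numbered [i], and is empty when there is no such centre. *)
Lemma separable_countable_base (R : realType) (X : metricType R) :
  separable X -> exists B : nat -> set X, countable_base B.
Proof.
move=> [D /countable_injP[e eD] dD].
pose C i m : set X := \bigcup_(d in [set d | D d /\ e d = i]) (ball d m.+1%:R^-1)^°.
exists (fun i => if unpickle i is Some p then C p.1 p.2 else set0); split.
  move=> i; case: unpickle => [p|]; last exact: open0.
  by apply: bigcup_open => d _; exact: open_interior.
move=> x W oW Wx.
have /nbhs_ballP[r /= r0 rW] : nbhs x W by exact: open_nbhs_nbhs.
have [m _ mr] := near_infty_natSinv_lt (PosNum (divr_gt0 r0 (ltr0n R 2))).
pose s : R := m.+1%:R^-1.
have {mr} sr : s < r / 2 by exact: (mr m (leqnn m)).
have s0 : 0 < s by rewrite invr_gt0.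
have [||d [/interior_subset xd Dd]] := dD (ball x (s / 2))^°.
- by exists x; apply: nbhsx_ballx; exact: divr_gt0.
- exact: open_interior.
exists (pickle (e d, m)); rewrite pickleK /=; split.
  exists d => //; apply/nbhs_ballP; exists (s / 2); first exact: divr_gt0.
  by move=> y; rewrite -/s => xy; rewrite [s]splitr;
    exact: ball_triangle (ball_sym xd) xy.
move=> y [d' [Dd' edd'] /interior_subset d'y].
have dd' : d' = d by apply: eD => //; exact/mem_set.
rewrite {}dd' in d'y; apply: rW; apply: le_ball (ball_triangle xd d'y).
by rewrite -/s; lra.
Qed.

Section meager_sets.
Context {X : topologicalType}.
Implicit Types (A B E G O P U V W : set X).

Lemma meagerS A B : A `<=` B -> meager B -> meager A.
Proof. by move=> AB [F nF BF]; exists F => //; exact: subset_trans BF. Qed.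

Lemma nowhere_dense0 : nowhere_dense (@set0 X).
Proof. by rewrite /nowhere_dense closure0 interior0. Qed.

Lemma meager_bigcup (A : nat -> set X) :
  (forall n, meager (A n)) -> meager (\bigcup_n A n).
Proof.
move=> mA; have /choice[F FA] n : exists F : nat -> set X,
    (forall k, nowhere_dense (F k)) /\ A n `<=` \bigcup_k F k.
  by have [F nF AF] := mA n; exists F.
have [C [CF Ce]] := bigcup_double_seq F; exists C.
  move=> i; case: (CF i) => [->|[n [k ->]]]; first exact: nowhere_dense0.
  exact: (FA n).1.
by rewrite Ce; apply: subset_bigcup => n _; exact: (FA n).2.
Qed.

Lemma nowhere_dense_meager A : nowhere_dense A -> meager A.
Proof. by move=> nA; exists (fun=> A) => // x Ax; exists 0%N. Qed.

Lemma meagerU A B : meager A -> meager B -> meager (A `|` B).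
Proof.
by move=> mA mB; rewrite -bigcup2E; apply: meager_bigcup => -[|[|n]] //=;
  apply: nowhere_dense_meager; exact: nowhere_dense0.
Qed.

Lemma meager_closed_cover A : meager A ->
  exists H : nat -> set X, [/\ forall n, closed (H n), A `<=` \bigcup_n H n &
    meager (\bigcup_n H n)].
Proof.
move=> [F nF AF]; exists (fun n => closure (F n)); split.
- by move=> n; exact: closed_closure.
- by apply: subset_trans AF _; apply: subset_bigcup => n _; exact: subset_closure.
- apply: meager_bigcup => n; apply: nowhere_dense_meager.
  by rewrite /nowhere_dense -((closure_id _).1 (@closed_closure _ (F n))); exact: nF.
Qed.

Lemma GdeltaI P W : Gdelta P -> Gdelta W -> Gdelta (P `&` W).
Proof.
move=> [F oF ->] [H oH ->]; exists (fun i => F i `&` H i).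
  by move=> i; exact: openI.
by rewrite bigcapI.
Qed.

End meager_sets.

(** * Residual G-delta sets *)

Section category.
Context {R : realType} {X : metricType R}.
Implicit Types (A B E G O P U V W : set X) (D : set (set X)).
Context (B_ : nat -> set X) (baseB : countable_base B_).
Context (small : nat -> set (set X)) (small_gauge : gauge small).

(** The Baire category theorem: nested open sets avoid the nowhere dense sets
    one after the other and shrink to a point. *)
Lemma open_not_meager U : open U -> U !=set0 -> ~ meager U.
Proof.
move=> oU [x Ux] [F nF UF].
pose good n (V W : set X) := [/\ open W, W !=set0, closure W `<=` V,
  closure W `&` F n = set0 & small n (closure W)].
have step n V : open V -> V !=set0 -> exists W, good n V W.
  move=> oV V0.
  have [y [Vy nFy]] : exists y, (V `\` closure (F n)) y.
    apply/not_existsP => VF; have [y Vy] := V0.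
    have : (closure (F n))^° y.
      apply: filterS (open_nbhs_nbhs (conj oV Vy)) => z Vz.
      by apply: contrapT => nFz; exact: (VF z).
    by rewrite (nF n).
  have [N yN sN] := gauge_nbhs small_gauge n y.
  have yW : nbhs y ((V `\` closure (F n)) `&` N).
    apply: filterI => //; apply: open_nbhs_nbhs; split => //.
    by rewrite setDE; apply: openI => //; exact/closed_openC/closed_closure.
  have [M yM MN] := uniform_regular yW.
  have MV : closure M^° `<=` (V `\` closure (F n)) `&` N.
    exact: subset_trans (closure_subset (@interior_subset _ M)) MN.
  exists M^°; split.
  - exact: open_interior.
  - by exists y.
  - by move=> z /MV[[]].
  - apply/seteqP; split => // z [/MV[[_ nz] _] Fz].
    by apply: nz; exact: subset_closure.
  - by apply: (gaugeS small_gauge (leqnn n) _ sN) => z /MV[].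
have [next nextP] : {next : nat * set X -> set X & forall nV,
    open nV.2 /\ nV.2 !=set0 -> good nV.1 nV.2 (next nV)}.
  apply: (@choice _ _ (fun nV W =>
    open nV.2 /\ nV.2 !=set0 -> good nV.1 nV.2 W)) => -[n V].
  have [[oV V0]|nV] := pselect (open V /\ V !=set0).
    by have [W] := step n V oV V0; exists W.
  by exists set0 => /nV.
pose W := fix W n := if n is m.+1 then next (m, W m) else U.
have oW n : open (W n) /\ W n !=set0.
  elim: n => [|n /(nextP (n, W n))[? ? _ _ _]//]; first by split; [|exists x].
have gW n : good n (W n) (W n.+1) by exact: (nextP (n, W n) (oW n)).
have [|||n|z Wz] := @gauge_complete _ _ small_gauge (fun n => closure (W n.+1)).
- by move=> n; exact: closed_closure.
- by move=> n; have [y Wy] := (oW n.+1).2; exists y; exact: subset_closure.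
- move=> n; have [_ _ WW _ _] := gW n.+1.
  by apply: subset_trans WW _; exact: subset_closure.
- by case: (gW n).
have [n _ Fz] : (\bigcup_n F n) z.
  by apply: UF; have [_ _ WU _ _] := gW 0%N; exact/WU/Wz.
have [_ _ _ WF _] := gW n.
by have : (closure (W n.+1) `&` F n) z; [split => //; exact: Wz|rewrite WF].
Qed.

Lemma G_Res_locally_rich : locally_rich (@G_Res X).
Proof.
move=> P SP; exists P; split => // W oW [x [Wx Px]].
have [GP [U [oU U0 [PU mUP]]]] := SP.
exists (W `&` P) => //; split; first exact: GdeltaI (open_Gdelta oW) GP.
exists (W `&` U); split.
- exact: openI.
- by exists x; split => //; exact: PU.
- split; first exact: setIS.
  by apply: meagerS mUP => y [[Wy Uy] nP]; split => // Py; exact: nP.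
Qed.

(** Pick an element of [D] inside each basic open set that meets [U].  The open
    sets in which these elements are residual meet every such basic set, as a
    non-empty open set is not meager; so their union is dense in [U]. *)
Lemma G_Res_exhaustion D P U : dense_in (@G_Res X) D ->
  Gdelta P -> open U -> residual_in P U ->
  exists V G : nat -> set X, [/\ forall n, open (V n),
    forall n, V n !=set0 -> D (G n), forall n, meager (V n `\` G n) &
    meager (U `\` \bigcup_n V n)].
Proof.
move=> dD GP oU [PU mUP]; have [oB bB] := baseB.
(* Basic sets that miss [U] get the empty set. *)
have /choice[VG VGP] n : exists VG : set X * set X, [/\ open VG.1,
    VG.1 `<=` B_ n, VG.1 !=set0 -> D VG.2, meager (VG.1 `\` VG.2) &
    B_ n `&` U !=set0 -> VG.1 !=set0].
  have [BU|nBU] := pselect (B_ n `&` U !=set0); last first.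
    exists (set0, set0) => /=; split => //; first exact: open0.
    - by move=> [].
    - by rewrite set0D; apply: nowhere_dense_meager; exact: nowhere_dense0.
  have [|G [[GG [W [oW W0 [GW mWG]]]] DG GPB]] := dD (B_ n `&` P).
    split; first exact: GdeltaI (open_Gdelta (oB n)) GP.
    exists (B_ n `&` U); split => //; first exact: openI.
    split; first exact: setIS.
    by apply: meagerS mUP => y [[By Uy] nP]; split => // Py; exact: nP.
  exists (W `&` B_ n, G) => /=; split => //.
  - exact: openI.
  - by apply: meagerS mWG => y [[]].
  - move=> _; apply: contrapT => WB0; apply: (open_not_meager oW W0).
    apply: meagerS mWG => y Wy; split => // Gy.
    by apply: WB0; exists y; split => //; have [] := GPB y Gy.
exists (fun n => (VG n).1), (fun n => (VG n).2); split.
- by move=> n; have [] := VGP n.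
- by move=> n; have [] := VGP n.
- by move=> n; have [] := VGP n.
apply: nowhere_dense_meager; set A := _ `\` _.
apply/seteqP; split => // x; rewrite /interior /= nbhsE => -[N [oN Nx] NA].
have [y [[Uy _] Ny]] := NA x Nx N (open_nbhs_nbhs (conj oN Nx)).
have [n [By BNU]] := bB y (N `&` U) (openI oN oU) (conj Ny Uy).
have [oV VB _ _ VU] := VGP n.
have [|z Vz] := VU; first by exists y.
have [Nz _] := BNU z (VB z Vz).
have [w [[_ nVw] Vw]] := NA z Nz _ (open_nbhs_nbhs (conj oV Vz)).
by apply: nVw; exists n.
Qed.

(** The exhausting sets [G] are residual in open sets [V].  Removing the meager
    set [M n] leaves [G] and [V] with the same points, so that [G] becomes
    relatively open; enlarging the union of the [M n] to a meager F-sigma set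
    keeps the result G-delta. *)
Lemma G_Res_has_fusion : has_fusion (@G_Res X).
Proof.
move=> D_ dD P [GP [U [oU U0 resP]]].
have /choice[VG VGP] n : exists VG : (nat -> set X) * (nat -> set X),
    [/\ forall k, open (VG.1 k), forall k, VG.1 k !=set0 -> D_ n (VG.2 k),
     forall k, meager (VG.1 k `\` VG.2 k) & meager (U `\` \bigcup_k VG.1 k)].
  by have [V [G VG]] := G_Res_exhaustion (dD n) GP oU resP; exists (V, G).
pose M n := (U `\` \bigcup_k (VG n).1 k) `|`
  \bigcup_k ((VG n).1 k `\` (VG n).2 k).
have /meager_closed_cover[H [cH MH mH]] : meager (\bigcup_n M n).
  apply: meager_bigcup => n; have [_ _ mVG mU] := VGP n.
  by apply: meagerU => //; exact: meager_bigcup.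
pose Q := P `&` \bigcap_n ~` H n.
have QM x n : Q x -> ~ M n x.
  move=> [_ nHx] Mx; have [k _ Hx] : (\bigcup_n H n) x by apply: MH; exists n.
  exact: nHx Hx.
exists Q; split.
- split.
    apply: GdeltaI => //; exists (fun n => ~` H n) => // n.
    exact: closed_openC.
  exists U; split => //; split; first by move=> x [/resP.1].
  apply: (@meagerS _ _ ((U `\` P) `|` \bigcup_n H n)); last first.
    by apply: meagerU => //; exact: resP.2.
  move=> x [Ux nQ]; have [Px|nPx] := pselect (P x); last by left.
  right; apply: contrapT => nHx; apply: nQ; split => // n _ Hx.
  by apply: nHx; exists n.
- by move=> x [].
- move=> n x Qx; have [oV DG _ _] := VGP n.
  have [k _ Vx] : (\bigcup_k (VG n).1 k) x.
    apply: contrapT => nV; apply: (QM x n Qx); left; split => //.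
    exact/resP.1/Qx.1.
  exists ((VG n).1 k), ((VG n).2 k); split => //; first by apply: DG; exists x.
  move=> y [Vy Qy]; apply: contrapT => nGy; apply: (QM y n Qy).
  by right; exists k.
Qed.

(** Up to a meager set, [E] is the union of the open sets in which an
    exhausting element contained in [E] is residual. *)
Lemma decided_G_Res_baire E : decided (@G_Res X) E -> baire_property E.
Proof.
move=> /decided_dense dE.
have resT : residual_in [set: X] [set: X].
  by split => //; rewrite setDv; apply: nowhere_dense_meager; exact: nowhere_dense0.
have [V [G [oV DG mVG mV]]] := G_Res_exhaustion dE (open_Gdelta openT) openT resT.
pose I := [set n | G n `<=` E].
exists (\bigcup_(n in I) V n); first by apply: bigcup_open => n _; exact: oV.
apply: (@meagerS _ _ ((setT `\` \bigcup_n V n) `|` \bigcup_n (V n `\` G n))).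
  move=> x [[Ex nVx]|[[n GE Vx] nEx]]; last first.
    by right; exists n => //; split => // /GE.
  have [[n _ Vx]|nV] := pselect ((\bigcup_n V n) x); last by left.
  right; exists n => //; split => // Gx.
  have [|GE|nGE] := DG n; first by exists x.
    by apply: nVx; exists n.
  exact: nGE Gx Ex.
by apply: meagerU => //; exact: meager_bigcup.
Qed.

End category.

(** * Perfect sets of positive measure *)

(** The [n]-th set is allowed a share [r / 2 ^ n.+1] of some real [r] below
    [e]. *)
Lemma measure_bigcup_choice d (T : measurableType d) (R : realType)
    (mu : {measure set T -> \bar R}) (A : nat -> set (set T)) (e : \bar R) :
  (forall n, A n `<=` measurable) ->
  (forall n (r : R), 0 < r -> exists2 B, A n B & (mu B < r%:E)%E) ->
  (0 < e)%E ->
  exists B : nat -> set T, (forall n, A n (B n)) /\ (mu (\bigcup_n B n) < e)%E.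
Proof.
move=> mA smallA e0.
have [r r0 re] : exists2 r : R, 0 < r & (r%:E < e)%E.
  case: e e0 => [e||//]; last by exists 1 => //; exact: ltry.
  rewrite lte_fin => e0; exists (e / 2); first exact: divr_gt0.
  by rewrite lte_fin gtr_pMr ?invf_lt1 ?ltr1n.
have /choice[B BP] n : exists B, A n B /\ (mu B < (r / (2 ^ n.+1)%:R)%:E)%E.
  have [|B AB Br] := smallA n (r / (2 ^ n.+1)%:R); last by exists B.
  by rewrite divr_gt0// ltr0n expn_gt0.
have mB n : measurable (B n) by apply: mA; exact: (BP n).1.
exists B; split; first by move=> n; exact: (BP n).1.
apply: le_lt_trans re; apply: le_trans (epsilon_trick0 predT (ltW r0)).
apply: (@le_trans _ _ (\sum_(0 <= n <oo) mu (B n))%E).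
  by apply: measure_sigma_subadditive => //; exact: bigcup_measurable.
by apply: lee_nneseries => // n _; apply/ltW; exact: (BP n).2.
Qed.

Section perfect_positive.
Context {R : realType} {X : metricType R} (x0 : X).
Notation BX := (borelType x0).
Context (mu : {finite_measure set BX -> \bar R}).
Implicit Types (A B C F P Q U V W : set X) (D : set (set X)).

Let openM A : open A -> measurable (A : set BX).
Proof. exact: sub_sigma_algebra. Qed.

Let closedM A : closed A -> measurable (A : set BX).
Proof.
by move=> /closed_openC /openM/measurableC; rewrite setCK.
Qed.

Let mufin A : measurable (A : set BX) -> (mu A < +oo)%E.
Proof. by move=> mA; rewrite ltey_eq fin_num_measure. Qed.

Let measurable_nonincr_small (A : nat -> set BX) (r : R) : 0 < r ->
  (forall n, measurable (A n)) -> (forall n, A n.+1 `<=` A n) ->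
  mu (\bigcap_n A n) = 0%E -> exists n, (mu (A n) < r%:E)%E.
Proof.
move=> r0 mA AS A0.
have ndA : {homo A : n m / (n <= m)%N >-> (m <= n)%O}.
  by apply/nonincreasing_seqP => n; rewrite subsetEset; exact: AS.
have nr : nbhs (mu (\bigcap_n A n)) [set y | (y < r%:E)%E].
  by rewrite A0; exact: (@nbhs_open_ereal_lt _ 0 (fun=> r)).
have [n _ nA] := nonincreasing_cvg_mu (mufin (mA 0%N)) mA
  (bigcapT_measurable mA) ndA nr.
by exists n; exact: (nA n (leqnn n)).
Qed.

(** A closed set is the intersection of its metric neighbourhoods of radius
    [1/(n+1)]; finiteness of the measure gives continuity from above. *)
Lemma closed_outer_small C (r : R) : closed C -> 0 < r ->
  exists V, [/\ open V, C `<=` V & (mu (V `\` C) < r%:E)%E].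
Proof.
move=> cC r0.
pose V n : set X := \bigcup_(x in C) (ball x n.+1%:R^-1)^°.
have oV n : open (V n) by apply: bigcup_open => x _; exact: open_interior.
have CV n : C `<=` V n.
  by move=> x Cx; exists x => //; apply: nbhsx_ballx; rewrite invr_gt0.
have [|||n Vn] := @measurable_nonincr_small (fun n => V n `\` C) r r0.
- by move=> n; apply: measurableD; [exact: openM|exact: closedM].
- move=> n; apply: setSD => y [x Cx xy]; exists x => //.
  apply: interiorS xy; apply: le_ball.
  by rewrite lef_pV2 ?posrE ?ltr0n// ler_nat.
- rewrite (_ : \bigcap_n _ = set0) ?measure0//; apply/seteqP; split => // y VCy.
  apply: (VCy 0%N I).2; apply: cC => N /nbhs_ballP[e /= e0 eN].
  have /= [n _ ne] := near_infty_natSinv_lt (PosNum e0).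
  have [[x Cx /interior_subset xy] _] := VCy n I; exists x; split => //.
  by apply: eN; apply: ball_sym; apply: le_ball xy; exact/ltW/ne/leqnn.
by exists (V n).
Qed.

(** Enlarge each [C n] to an open [V n] so that in total less than the measure
    of the complement is added; what remains outside the [V n] is closed. *)
Lemma closed_complement_positive (C : nat -> set X) :
  (forall n, closed (C n)) -> (0 < mu (~` \bigcup_n C n))%E ->
  exists F, [/\ closed F, (0 < mu F)%E & F `<=` ~` \bigcup_n C n].
Proof.
move=> cC mC.
have mK : measurable (\bigcup_n C n : set BX).
  by apply: bigcup_measurable => n _; exact: closedM.
pose A n : set (set X) := [set B | exists V, [/\ open V, C n `<=` V & B = V `\` C n]].
have mA n : A n `<=` (measurable : set (set BX)).
  by move=> _ [V [oV _ ->]]; apply: measurableD; [exact: openM|exact: closedM].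
have [|B [AB mB]] := measure_bigcup_choice (mu := mu) mA _ mC.
  move=> n r r0; have [V [oV CV mV]] := closed_outer_small (cC n) r0.
  by exists (V `\` C n) => //; exists V.
have /choice[V VP] := AB.
have oVT : open (\bigcup_n V n) by apply: bigcup_open => n _; case: (VP n).
have mBT : measurable (\bigcup_n B n : set BX).
  by apply: bigcup_measurable => n _; exact: mA (AB n).
have mF : measurable (~` \bigcup_n V n : set BX) by apply: measurableC; exact: openM.
exists (~` \bigcup_n V n); split; first exact: open_closedC.
- rewrite lt0e measure_ge0 andbT; apply: contraTN mB => /eqP F0.
  rewrite -leNgt -[leRHS]add0e -F0; apply: le_trans (measureU2 _ mF mBT).
  apply: le_measure; [exact/mem_set/measurableC|exact/mem_set/measurableU|].
  move=> x nCx; have [[n _ Vx]|nV] := pselect ((\bigcup_n V n) x); last by left.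
  right; exists n => //; have [_ _ ->] := VP n; split => // Cx.
  by apply: nCx; exists n.
- by apply: subsetC => x [n _ Cx]; exists n => //; have [_ + _] := VP n; exact.
Qed.

Lemma nonatomic_set1 x : nonatomic mu -> mu [set x] = 0%E.
Proof.
move=> na; have m1 : measurable ([set x] : set BX).
  by apply: closedM; exact/accessible_closed_set1/hausdorff_accessible/metric_hausdorff.
apply/eqP; apply: contrapT => /negP mx.
have [|B [mB Bx B0 lB]] := na _ m1; first by rewrite lt0e mx measure_ge0.
have [Be|/set0P[y By]] := eqVneq B set0.
  by move: B0; rewrite Be measure0 ltxx.
suff Be : B = [set x] by move: lB; rewrite Be ltxx.
by apply/seteqP; split => // _ ->; have <- := Bx _ By.
Qed.

Context (B_ : nat -> set X) (baseB : countable_base B_).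
Context (mu_nonatomic : nonatomic mu).

(** The support of the measure restricted to [F]: delete the basic open sets
    that meet [F] in a null set.  An isolated point of what is left would be a
    point of positive mass. *)
Lemma closed_positive_core F : closed F -> (0 < mu F)%E ->
  exists Q, [/\ Perf_pos mu Q, Q `<=` F &
    forall W, open W -> W `&` Q !=set0 -> (0 < mu (W `&` Q))%E].
Proof.
move=> cF F0; have [oB bB] := baseB.
pose N n : set X := if mu (F `&` B_ n) == 0%E then B_ n else set0.
have oN n : open (N n) by rewrite /N; case: ifP => // _; exact: open0.
pose Q := F `&` ~` \bigcup_n N n.
have cQ : closed Q.
  by apply: closedI => //; apply: open_closedC; apply: bigcup_open => n _.
have mFB n : measurable (F `&` B_ n : set BX).
  by apply: measurableI; [exact: closedM|exact: openM].
have FN : mu.-negligible (F `&` \bigcup_n N n : set BX).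
  rewrite setI_bigcupr; apply: negligible_bigcup => n; rewrite /N.
  case: ifPn => [/eqP nB|_]; last by rewrite setI0; exact: negligible_set0.
  by apply/negligibleP => //; exact: mFB.
have Qpos W : open W -> W `&` Q !=set0 -> (0 < mu (W `&` Q))%E.
  move=> oW [x [Wx [Fx nNx]]].
  have [n [Bx BW]] := bB x W oW Wx.
  rewrite lt0e measure_ge0 andbT; apply/eqP => WQ0; apply: nNx; exists n => //.
  suff nB : mu (F `&` B_ n) = 0%E by rewrite /N nB eqxx.
  apply: (measure_negligible (mFB n)).
  have nWQ : mu.-negligible (W `&` Q : set BX).
    apply/negligibleP => //; apply: measurableI; [exact: openM|exact: closedM].
  apply: negligibleS (negligibleU nWQ FN) => y [Fy By].
  by have [Ny|nNy] := pselect ((\bigcup_n N n) y); [right|left; split => //; exact: BW].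
have Q0 : (0 < mu Q)%E.
  rewrite lt0e measure_ge0 andbT; apply: contraTN F0 => /eqP Q0.
  rewrite (_ : mu F = 0%E) ?ltxx//; apply: measure_negligible; first exact: closedM.
  have nQ : mu.-negligible (Q : set BX) by apply/negligibleP => //; exact: closedM.
  apply: negligibleS (negligibleU nQ FN) => y Fy.
  by have [Ny|nNy] := pselect ((\bigcup_n N n) y); [right|left].
exists Q; split => //; last by move=> x [].
split => //; split => //; apply/seteqP; split => x.
  by move=> /subset_limit_point; rewrite -(closure_id _).1.
move=> Qx V xV; apply: contrapT => nV.
have : (0 < mu (V^° `&` Q))%E.
  by apply: Qpos; [exact: open_interior|exists x].
suff -> : mu (V^° `&` Q) = 0%E by rewrite ltxx.
apply/eqP; rewrite eq_le measure_ge0 andbT -(nonatomic_set1 x mu_nonatomic).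
apply: le_measure; rewrite ?inE.
- by apply: measurableI; [exact: openM (@open_interior _ V)|exact: closedM].
- by apply: closedM; exact/accessible_closed_set1/hausdorff_accessible/metric_hausdorff.
- move=> y [Vy Qy] /=; apply: contrapT => /eqP yx; apply: nV; exists y; split => //.
  exact: interior_subset.
Qed.

Lemma Perf_pos_locally_rich : locally_rich (Perf_pos mu).
Proof.
move=> P [[cP lP] P0]; have [Q [PQ QP Qpos]] := closed_positive_core cP P0.
exists Q; split => // W oW [x [Wx Qx]].
have [V [oV Vx PV VW]] := perfect_piece PQ.1 oW Wx Qx.
exists (closure (V `&` Q)) => //; split; first by case: PV.
apply: lt_le_trans (Qpos V oV _) _; first by exists x.
apply: le_measure; rewrite ?inE; last exact: subset_closure.
- by apply: measurableI; [exact: openM|apply: closedM; case: PQ => -[]].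
- by apply: closedM; exact: closed_closure.
Qed.

(** Among the countable unions of closed elements of [D] one has maximal
    measure; if its complement had positive measure, it would contain a further
    element of [D]. *)
Lemma Perf_pos_exhaustion D : dense_in (Perf_pos mu) D ->
  exists C : nat -> set X, [/\ forall n, closed (C n),
    forall n, C n !=set0 -> D (C n) & mu (~` \bigcup_n C n) = 0%E].
Proof.
move=> dD.
(* Empty terms are allowed, so that finite unions are of this form too. *)
pose K : set (set X) := [set A | exists C : nat -> set X,
  [/\ forall n, closed (C n), forall n, C n !=set0 -> D (C n) & A = \bigcup_n C n]].
have mK A : K A -> measurable (A : set BX).
  by move=> [C [cC _ ->]]; apply: bigcup_measurable => n _; exact: closedM.
have KU (A : nat -> set X) : (forall n, K (A n)) -> K (\bigcup_n A n).
  move=> /choice[C CP]; have [C' [C'C eC]] := bigcup_double_seq C.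
  exists C'; split.
  - move=> i; case: (C'C i) => [->|[n [k ->]]]; first exact: closed0.
    by have [+ _ _] := CP n; exact.
  - move=> i; case: (C'C i) => [->[]//|[n [k ->]]].
    by have [_ + _] := CP n; exact.
  - by rewrite eC; apply: eq_bigcupr => n _; have [_ _ ->] := CP n.
pose s := ereal_sup [set mu A | A in K].
have K0 : K set0.
  exists (fun=> set0); split; [by move=> _; exact: closed0|by move=> _ []|].
  by rewrite bigcup_const //; exists 0%N.
have sfin : s \is a fin_num.
  rewrite ge0_fin_numE; last by apply: ereal_sup_ubound; exists set0; rewrite ?measure0.
  apply: le_lt_trans (mufin (@measurableT _ BX)).
  apply: ge_ereal_sup => _ [A KA <-]; apply: le_measure; rewrite ?inE //.
  exact: mK.
have /choice[A AP] n : exists A, K A /\ (s - n.+1%:R^-1%:E < mu A)%E.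
  have [|_ [A KA <-] sA] := @ub_ereal_sup_adherent _ _ n.+1%:R^-1 _ sfin; last by exists A.
  by rewrite invr_gt0.
have KA : K (\bigcup_n A n) by apply: KU => n; exact: (AP n).1.
have sA : (s <= mu (\bigcup_n A n))%E.
  apply/lee_addgt0Pr => e e0.
  have /= [n _ ne] := near_infty_natSinv_lt (PosNum e0).
  have := (AP n).2; rewrite lteBlDr // => /ltW/le_trans; apply.
  apply: leeD; last by rewrite lee_fin; exact/ltW/ne/leqnn.
  apply: le_measure; rewrite ?inE; [exact: mK (AP n).1|exact: mK|].
  by move=> x Ax; exists n.
have [C [cC DC eC]] := KA; exists C; split => //; rewrite -eC.
apply/eqP; rewrite eq_le measure_ge0 andbT leNgt; apply/negP => c0.
rewrite eC in c0; have [F [cF F0 FC]] := closed_complement_positive cC c0.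
have [Q1 [PQ1 Q1F _]] := closed_positive_core cF F0.
have [Q [PQ DQ QQ1]] := dD _ PQ1.
have cQ : closed Q by case: PQ => -[].
have QA : (\bigcup_n A n) `&` Q = set0.
  by apply/seteqP; split => // x [Ax /QQ1 /Q1F /FC]; rewrite -eC.
have KAQ : K (\bigcup_n A n `|` Q).
  rewrite -bigcup2E; apply: KU => -[|[|n]] //=.
  exists (fun=> Q); split => //; rewrite bigcup_const //; by exists 0%N.
have : (mu (\bigcup_n A n `|` Q) <= s)%E.
  by apply: ereal_sup_ubound; exists (\bigcup_n A n `|` Q).
rewrite measureU //; [|exact: mK|exact: closedM].
apply/negP; rewrite -ltNge; apply: (@lt_le_trans _ _ (s + mu Q)%E).
  by rewrite lteDl //; exact: PQ.2.
exact: leeD.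
Qed.

(** Delete [V k `\` C k] for a thin open neighbourhood [V k] of each exhausting
    set [C k], which makes [C k] relatively open, and delete the complement of a
    finite union of the [C k], so that they cover what remains. *)
Lemma Perf_pos_locally_in D (r : R) : dense_in (Perf_pos mu) D -> 0 < r ->
  exists F, [/\ closed F, (mu (~` F) < r%:E)%E & locally_in D F].
Proof.
move=> /Perf_pos_exhaustion[C [cC DC C0]] r0.
(* The admissible choices for the [n]-th deleted set: index 0 is the
   complement of a finite union, index [k.+1] is the collar around [C k]. *)
pose A n : set (set X) := if n is k.+1
  then [set B | exists V, [/\ open V, C k `<=` V & B = V `\` C k]]
  else [set B | exists m, B = ~` \bigcup_(k in `I_m) C k].
have oA n B : A n B -> open B.
  case: n => [[m ->]|k [V [oV _ ->]]].
    by apply/closed_openC/closed_bigcup => // k _; exact: cC.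
  by rewrite setDE; apply: openI => //; exact: closed_openC.
have [||/=|B [AB mB]] := @measure_bigcup_choice _ _ _ mu A r%:E.
- by move=> n B /oA; exact: openM.
- move=> [|k] e e0; last first.
    by have [V [oV CV mV]] := closed_outer_small (cC k) e0; exists (V `\` C k) => //; exists V.
  have [|||m mm] := @measurable_nonincr_small (fun m => ~` \bigcup_(k in `I_m) C k) e e0.
  + by move=> m; apply: measurableC; apply: bigcup_measurable => k _; exact: closedM.
  + by move=> m; apply: subsetC; apply: bigcup_subset => k /= /ltnW.
  + rewrite -C0; congr (mu _); apply/seteqP; split => x.
      by move=> nC [k _ Cx]; apply: (nC k.+1 I); exists k => /=.
    by move=> nC m _ [k _ Cx]; apply: nC; exists k.
  by exists (~` \bigcup_(k in `I_m) C k) => //; exists m.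
- by rewrite lte_fin.
exists (~` \bigcup_n B n); split.
- by apply: open_closedC; apply: bigcup_open => n _; exact: oA (AB n).
- by rewrite setCK.
move=> x nBx; have [m Bm] := AB 0%N.
have [k _ Cx] : (\bigcup_(k in `I_m) C k) x.
  by apply: contrapT => nCx; apply: nBx; exists 0%N => //; rewrite Bm.
have [V [oV CV BV]] := AB k.+1.
exists V, (C k); split => //; [exact: CV|by apply: DC; exists x|].
move=> y [Vy nBy]; apply: contrapT => nCy; apply: nBy; exists k.+1 => //.
by rewrite BV.
Qed.

(** For each [n] a closed set that works for [D_ n] and has a small complement;
    the losses add up to less than the measure of [P], and the core of what
    remains of [P] is perfect. *)
Lemma Perf_pos_has_fusion : has_fusion (Perf_pos mu).
Proof.
move=> D_ dD P [[cP lP] P0].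
pose A n : set (set X) := [set B | exists F,
  [/\ closed F, locally_in (D_ n) F & B = ~` F]].
have oA n B : A n B -> open B by move=> [F [cF _ ->]]; exact: closed_openC.
have [||B [AB mB]] := @measure_bigcup_choice _ _ _ mu A _ _ _ P0.
- by move=> n B /oA; exact: openM.
- move=> n r /(Perf_pos_locally_in (dD n))[F [cF mF DF]].
  by exists (~` F) => //; exists F.
have oB : open (\bigcup_n B n) by apply: bigcup_open => n _; exact: oA (AB n).
pose F := P `\` \bigcup_n B n.
have cF : closed F by apply: closedI => //; exact: open_closedC.
have F0 : (0 < mu F)%E.
  rewrite lt0e measure_ge0 andbT; apply: contraTN mB => /eqP F0.
  rewrite -leNgt -[leRHS]add0e -F0.
  apply: le_trans (measureU2 _ (closedM cF) (openM oB)).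
  apply: le_measure; rewrite ?inE; first exact: closedM.
    by apply: measurableU; [exact: closedM|exact: openM].
  by move=> x Px; have [Bx|nBx] := pselect ((\bigcup_n B n) x); [right|left].
have [Q [PQ QF _]] := closed_positive_core cF F0; exists Q; split => //.
  by move=> x /QF[].
move=> n; have [G [_ DG BG]] := AB n; apply: locally_inS DG => x /QF[_ nBx].
by apply: contrapT => nGx; apply: nBx; exists n => //; rewrite BG.
Qed.

(** Up to a null set, [E] is the union of the exhausting sets inside [E]. *)
Lemma decided_Perf_pos_completed E : decided (Perf_pos mu) E ->
  completed_algebra_gen mu E.
Proof.
move=> /decided_dense/Perf_pos_exhaustion[C [cC DC C0]].
have mC (I : set nat) : measurable (\bigcup_(n in I) C n : set BX).
  by apply: bigcup_measurable => n _; exact: closedM.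
exists (\bigcup_(n in [set n | C n `<=` E]) C n) => //.
exists (E `\` \bigcup_n C n).
  exists (~` \bigcup_n C n); split; [|exact: C0|by move=> x []].
  by apply: measurableC; exact: mC.
apply/seteqP; split => x; first by move=> [[n CE /CE]//|[]].
move=> Ex; have [[n _ Cx]|nC] := pselect ((\bigcup_n C n) x); last by right.
left; exists n => //=; have [|//|CE] := DC n; first by exists x.
by case: (CE x Cx).
Qed.

End perfect_positive.

(** * Measurability and continuous restrictions *)

Theorem proposition4p1 (R : realType) (X : metricType R)
    (X_polish : polish R X) (X_no_isolated : isolated [set: X] = set0)
    (f : X -> R) :
  (HSOP Perf f -> marczewski_measurable f) /\
  (forall (x0 : X) (mu : {finite_measure set (borelType x0) -> \bar R}),
     nonatomic mu ->
     HSOP (Perf_pos mu) f -> measurable_for (completed_algebra_gen mu) f) /\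
  (HSOP G_Res f -> baire_measurable f) /\
  (HSOP Perf f <-> HCRP Perf f) /\
  (forall (x0 : X) (mu : {finite_measure set (borelType x0) -> \bar R}),
     nonatomic mu ->
     (HSOP (Perf_pos mu) f <-> HCRP (Perf_pos mu) f)) /\
  (HSOP G_Res f <-> HCRP G_Res f).
Proof.
have [sepX complX] := X_polish.
have [small small_gauge] := gauge_completely_metrizable complX.
have [B_ baseB] := separable_countable_base sepX.
have richP := @Perf_locally_rich R X.
have fusP := Perf_has_fusion small_gauge.
have richG := @G_Res_locally_rich R X.
have fusG := G_Res_has_fusion baseB small_gauge.
split; first exact: HSOP_decided.
split.
  move=> x0 mu na oscf A mA; apply: (decided_Perf_pos_completed baseB na).
  apply: HSOP_decided oscf A mA; first exact: Perf_pos_locally_rich baseB na.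
  exact: Perf_pos_has_fusion baseB na.
split.
  move=> oscf A mA; apply: (decided_G_Res_baire baseB small_gauge).
  exact: (HSOP_decided richG fusG oscf).
split; first by split; [exact: HSOP_HCRP|exact: HCRP_HSOP].
split; last by split; [exact: HSOP_HCRP|exact: HCRP_HSOP].
move=> x0 mu na; split; last exact: HCRP_HSOP.
apply: HSOP_HCRP; first exact: Perf_pos_locally_rich baseB na.
exact: Perf_pos_has_fusion baseB na.
Qed.
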